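(* Let $n$ be a positive integer and let $f \in \mathcal{P}_n$ be such that $f'$ has all its zeros outside the open unit disk. Then $$\|f'\|_{\infty} \leq n \, \|f\|_{\infty}.$$ Equality holds only for $f(x) = c\left((1 + x)^n - 2^{n-1}\right)$ or $f(x) = c\left((1-x)^n - 2^{n-1}\right)$ with a real constant $c \neq 0$.
   Context: $\mathcal{P}_n$ denotes the set of all polynomials of degree at most $n$ with real coefficients. $\|g\|_{\infty} := \max_{x \in [-1,1]} |g(x)|$. ''All zeros outside the open unit disk'' means that $f'$ has no complex zero $z$ with $|z| < 1$ (zeros on the unit circle are allowed; the identically zero polynomial does not satisfy this condition). *)

(* Defs.v *)
From HB Require Import structures.
From mathcomp Require Import all_boot all_order all_algebra.
From mathcomp Require Import all_real_closed.
From mathcomp Require Import classical_sets set_interval reals.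
Set Implicit Arguments.
Unset Strict Implicit.
Unset Printing Implicit Defensive.
Import Order.TTheory GRing.Theory Num.Theory.
Local Open Scope classical_set_scope.
Local Open Scope ring_scope.

(* The set is nonempty and bounded, and the supremum is attained by continuity,
   so it is the maximum. *)
Definition supnorm (R : realType) (g : {poly R}) : R :=
  sup [set `|g.[x]| | x in `[-1, 1]].

(* The zero polynomial is excluded: every z, in particular 0, is a root of it. *)
Definition zeros_outside_open_disk (R : realType) (p : {poly R}) : Prop :=
  forall z : R[i], root (map_poly (real_complex R) p) z -> ~~ (`|z| < 1).

(* Main.v *)
(* A quadratic x^2 - 2ax + r^2 with |a| <= r and r >= 1 is a nonnegative
   combination of (1+x)^2, 1-x^2 and (1-x)^2, and up to sign a factor x - a with
   |a| >= 1 is a nonnegative combination of 1+x and 1-x. Hence, up to sign,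
   f' = sum_k d_k B_k with d_k >= 0, where the B_k are the Bernstein polynomials
   of degree n-1 on [-1,1]. As 0 <= B_k <= 1 and each B_k has integral 2/n,
   f' <= sum_k d_k = (n/2) (f(1) - f(-1)) <= n ||f||. On either half of [-1,1]
   one of the two extreme B_k is at least 2^(1-n), so equality kills every d_k
   but d_{n-1}, or every d_k but d_0. *)
Require Import Defs.
From HB Require Import structures.
From mathcomp Require Import all_boot all_order all_algebra.
From mathcomp Require Import all_real_closed.
From mathcomp Require Import classical_sets set_interval reals.
From mathcomp Require Import ring lra.
Set Implicit Arguments.
Unset Strict Implicit.
Unset Printing Implicit Defensive.
Import Order.TTheory GRing.Theory Num.Theory.
Local Open Scope ring_scope.

Section BernsteinForm.
Variable R : realType.
Implicit Types (f g h : {poly R}) (m k : nat).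

(** * Cones of nonnegative Bernstein combinations *)

Definition bernstein m k : {poly R} :=
  (2^-1 ^+ m * 'C(m, k)%:R) *: ((1 + 'X) ^+ k * (1 - 'X) ^+ (m - k)).

Definition bernstein_nonneg m g :=
  exists2 d : nat -> R, forall k, 0 <= d k
    & g = \sum_(k < m.+1) d k *: bernstein m k.

(* Same cone as [bernstein_nonneg], without the binomial normalisation, which
   would get in the way of multiplication. *)
Definition lorentz_nonneg m g :=
  exists2 a : nat -> R, forall k, 0 <= a k
    & g = \sum_(k < m.+1) a k *: ((1 + 'X) ^+ k * (1 - 'X) ^+ (m - k)).

Lemma lorentz_nonnegD m g h :
  lorentz_nonneg m g -> lorentz_nonneg m h -> lorentz_nonneg m (g + h).
Proof.
move=> [a a0 ->] [b b0 ->]; exists (fun k => a k + b k) => [k|].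
  exact: addr_ge0.
by rewrite -big_split; apply: eq_bigr => k _; rewrite scalerDl.
Qed.

Lemma lorentz_nonnegZ m c g :
  0 <= c -> lorentz_nonneg m g -> lorentz_nonneg m (c *: g).
Proof.
move=> c0 [a a0 ->]; exists (fun k => c * a k) => [k|]; first exact: mulr_ge0.
by rewrite scaler_sumr; apply: eq_bigr => k _; rewrite scalerA.
Qed.

Lemma lorentz_nonneg_mul1DX m g :
  lorentz_nonneg m g -> lorentz_nonneg m.+1 ((1 + 'X) * g).
Proof.
move=> [a a0 ->]; exists (fun k => if k is k'.+1 then a k' else 0) => [[]//|].
rewrite [RHS]big_ord_recl /= scale0r add0r mulr_sumr; apply: eq_bigr => k _.
by rewrite -scalerAr mulrA -exprS subSS.
Qed.

Lemma lorentz_nonneg_mul1BX m g :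
  lorentz_nonneg m g -> lorentz_nonneg m.+1 ((1 - 'X) * g).
Proof.
(* Nothing controls [a] beyond [m] except its sign, so it is cut off before the sum gains the index
   [m.+1]. *)
move=> [a a0 ->]; exists (fun k => if (k <= m)%N then a k else 0) => [k|].
  by case: ifP.
rewrite [RHS]big_ord_recr /= ltnn scale0r addr0 mulr_sumr.
apply: eq_bigr => k _; rewrite -ltnS ltn_ord -scalerAr mulrCA -exprS subSn //.
by rewrite -ltnS.
Qed.

Lemma lorentz_nonneg_mul_linear m (A B : R) g : 0 <= A -> 0 <= B ->
  lorentz_nonneg m g ->
  lorentz_nonneg m.+1 ((A *: (1 + 'X) + B *: (1 - 'X)) * g).
Proof.
move=> A0 B0 Lg; rewrite mulrDl -!scalerAl; apply: lorentz_nonnegD.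
- exact/lorentz_nonnegZ/lorentz_nonneg_mul1DX.
- exact/lorentz_nonnegZ/lorentz_nonneg_mul1BX.
Qed.

Lemma lorentz_nonneg_mul_quadratic m (A B C : R) g :
  0 <= A -> 0 <= B -> 0 <= C -> lorentz_nonneg m g ->
  lorentz_nonneg m.+2 ((A *: (1 + 'X) ^+ 2 + B *: ((1 + 'X) * (1 - 'X))
                        + C *: (1 - 'X) ^+ 2) * g).
Proof.
move=> A0 B0 C0 Lg; rewrite 2!mulrDl -!scalerAl !expr2 -!mulrA.
have Lu := lorentz_nonneg_mul1DX Lg; have Lv := lorentz_nonneg_mul1BX Lg.
apply: lorentz_nonnegD; first apply: lorentz_nonnegD.
- exact/lorentz_nonnegZ/lorentz_nonneg_mul1DX.
- exact/lorentz_nonnegZ/lorentz_nonneg_mul1DX.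
- exact/lorentz_nonnegZ/lorentz_nonneg_mul1BX.
Qed.

(** Degree elevation by [1 = ((1 + 'X) + (1 - 'X)) / 2]. It ends the induction on factors, where the
    formal degree [m] may exceed the true one. *)
Lemma lorentz_nonneg_polyC m (c : R) : 0 <= c -> lorentz_nonneg m c%:P.
Proof.
move=> c0; elim: m => [|m IHm].
  exists (fun=> c) => [//|].
  by rewrite big_ord1 !expr0 mulr1 alg_polyC.
have h0 : 0 <= 2^-1 :> R by rewrite invr_ge0.
have := lorentz_nonneg_mul_linear h0 h0 IHm.
rewrite -scalerDr addrACA subrr addr0 -mulr2n -scaler_nat scalerA mulVf.
  by rewrite scale1r mul1r.
by rewrite pnatr_eq0.
Qed.

Lemma lorentz_nonneg_bernstein m g : lorentz_nonneg m g -> bernstein_nonneg m g.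
Proof.
(* For [k > m] the binomial is 0 and so is its inverse by convention; nonnegativity thus holds for
   every [k]. *)
move=> [a a0 ->]; exists (fun k => a k * (2^-1 ^+ m * 'C(m, k)%:R)^-1) => [k|].
  by rewrite mulr_ge0 // invr_ge0 mulr_ge0 // exprn_ge0 // invr_ge0.
apply: eq_bigr => k _; rewrite /bernstein scalerA -mulrA mulVf ?mulr1 //.
by rewrite mulf_neq0 // ?expf_neq0 ?invr_eq0 ?pnatr_eq0 // -lt0n bin_gt0 -ltnS.
Qed.

(** * From the location of the zeros to the cone *)

Lemma zeros_outside_open_disk_neq0 g : zeros_outside_open_disk g -> g != 0.
Proof.
move=> hg; apply/eqP => g0; have := hg 0.
by rewrite g0 rmorph0 root0 normr0 ltr01 => /(_ isT).
Qed.

Lemma zeros_outside_open_disk_mulr g h :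
  zeros_outside_open_disk (g * h) -> zeros_outside_open_disk g.
Proof. by move=> hgh z rz; apply: hgh; rewrite rmorphM rootM rz. Qed.

Lemma complex_norm_ge1 (a b : R) :
  ~~ (`|Complex a b| < 1) -> 1 <= a ^+ 2 + b ^+ 2.
Proof.
rewrite normc_def /= (_ : 1 = (1 : R)%:C%C) // ltcR -leNgt => h.
by rewrite -(@ler_sqrt _ 1) ?sqrtr1 // addr_ge0 ?sqr_ge0.
Qed.

Lemma size_monic_quadratic (b c : R) : size ('X^2 - b *: 'X + c%:P) = 3%N.
Proof.
rewrite -addrA size_polyDl size_polyXn // (leq_ltn_trans (size_polyD _ _)) //.
rewrite size_polyN gtn_max (leq_ltn_trans (size_scale_leq _ _)) ?size_polyX //.
by rewrite (leq_ltn_trans (size_polyC_leq1 _)).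
Qed.

(** The remainder modulo the quadratic is real, of degree at most 1, and vanishes at [a + ib]. Its
    imaginary part there is [b] times its slope, so the slope is 0, and then so is the constant
    term. *)
Lemma nonreal_root_dvdp g (a b : R) : b != 0 ->
  root (map_poly (real_complex R) g) (Complex a b) ->
  'X^2 - (2 * a) *: 'X + (a ^+ 2 + b ^+ 2)%:P %| g.
Proof.
move=> b0; set q := (X in X %| _) => rg.
have q0 : root (map_poly (real_complex R) q) (Complex a b).
  rewrite /q; set r2 := a ^+ 2 + b ^+ 2.
  rewrite rmorphD rmorphB /= map_polyZ map_polyXn map_polyX map_polyC.
  rewrite /root !hornerE; simpc; rewrite eq_complex /= /r2.
  by apply/andP; split; apply/eqP; ring.
have sq : size q = 3%N by exact: size_monic_quadratic.
apply/modp_eq0P; set r := g %% q.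
have : root (map_poly (real_complex R) r) (Complex a b).
  move: rg; rewrite {1}(divp_eq g q) rmorphD rmorphM /root hornerD hornerM.
  by rewrite (eqP q0) mulr0 add0r.
have sr : (size r <= 2)%N by rewrite -ltnS -sq ltn_modp -size_poly_eq0 sq.
rewrite (_ : r = r`_1 *: 'X + (r`_0)%:P); last first.
  apply/polyP => -[|[|i]]; rewrite !coefE /= ?mulr0 ?mulr1 ?add0r ?addr0 //.
  by rewrite nth_default // (leq_trans sr).
rewrite rmorphD /= map_polyZ map_polyX map_polyC /root !hornerE; simpc.
rewrite eq_complex /= mulf_eq0 (negPf b0) orbF => /andP[/[swap]/eqP->].
by rewrite mul0r add0r => /eqP->; rewrite scale0r add0r.
Qed.

(** Strong induction, since a nonreal root removes two degrees at once. The sign flips with each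
    real root [a >= 1], whence the disjunction. *)
Lemma zeros_outside_lorentz m g : (size g <= m.+1)%N ->
  zeros_outside_open_disk g -> lorentz_nonneg m g \/ lorentz_nonneg m (- g).
Proof.
elim/ltn_ind: m g => m IHm g sg hg; have g0 := zeros_outside_open_disk_neq0 hg.
have [sg1|sg1] := leqP (size g) 1.
  rewrite (size1_polyC sg1); case: (lerP 0 g`_0) => h.
    by left; apply: lorentz_nonneg_polyC.
  by right; rewrite -polyCN; apply: lorentz_nonneg_polyC; rewrite oppr_ge0 ltW.
have /closed_rootP[[a b] rz] : size (map_poly (real_complex R) g) != 1.
  by rewrite size_map_poly gtn_eqF.
have /complex_norm_ge1 nz := hg _ rz.
have [b0|b0] := eqVneq b 0.
  have ra : root g a by move: rz; rewrite b0 fmorph_root.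
  have /factor_theorem[h gE] := ra.
  have h0 : h != 0 by apply: contraNneq g0 => h0; rewrite gE h0 mul0r.
  have hh : zeros_outside_open_disk h.
    by apply: (@zeros_outside_open_disk_mulr _ ('X - a%:P)); rewrite -gE.
  have sgE : size g = (size h).+1.
    by rewrite gE size_Mmonic ?monicXsubC // size_XsubC addn2.
  case: m => [|m] in IHm sg *; first by rewrite leqNgt sg1 in sg.
  have := IHm m (ltnSn m) h _ hh; rewrite -ltnS -sgE => /(_ sg) Lh.
  (* The coefficients are half the values at 1 and -1. The sign [s] is chosen below, opposite to
     that of [a], to make both nonnegative. *)
  have hE (s : R) : (s * (1 - a) / 2) *: (1 + 'X)
      + (s * (- 1 - a) / 2) *: (1 - 'X) = s *: ('X - a%:P).
    by apply/polyP => i; rewrite !coefE; case: i => [|[|i]] /=; field.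
  have gE' : g = 1 *: ('X - a%:P) * h by rewrite scale1r mulrC.
  have gNE : - g = (-1) *: ('X - a%:P) * h by rewrite scaleN1r mulNr mulrC -gE.
  have gE'' : g = (-1) *: ('X - a%:P) * (- h) by rewrite scaleN1r mulrNN mulrC.
  have gNE' : - g = 1 *: ('X - a%:P) * (- h) by rewrite scale1r mulrN mulrC -gE.
  have [a1|a1] := lerP 0 a.
    have {}a1 : 1 <= a by move: nz; rewrite b0; nra.
    case: Lh => Lh; [right; rewrite gNE|left; rewrite gE''];
      rewrite -hE; apply: lorentz_nonneg_mul_linear => //; lra.
  have {}a1 : a <= -1 by move: nz; rewrite b0; nra.
  case: Lh => Lh; [left; rewrite gE'|right; rewrite gNE'];
    rewrite -hE; apply: lorentz_nonneg_mul_linear => //; lra.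
have /dvdpP[h gE] := nonreal_root_dvdp b0 rz.
set r2 := a ^+ 2 + b ^+ 2 in gE nz; set q := (X in h * X) in gE.
have h0 : h != 0 by apply: contraNneq g0 => h0; rewrite gE h0 mul0r.
have hh : zeros_outside_open_disk h.
  by apply: (@zeros_outside_open_disk_mulr _ q); rewrite -gE.
(* The outer coefficients are [q.[1] / 4] and [q.[-1] / 4], nonnegative because
   [r2 + 1 - 2 * a = (1 - a) ^+ 2 + b ^+ 2] and likewise for [- a]. The middle one needs [r2 >= 1],
   that is, a root outside the open disk. *)
have qE : ((r2 + 1 - 2 * a) / 4) *: (1 + 'X) ^+ 2
    + ((r2 - 1) / 2) *: ((1 + 'X) * (1 - 'X))
    + ((r2 + 1 + 2 * a) / 4) *: (1 - 'X) ^+ 2 = q.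
  have -> : (1 + 'X) ^+ 2 = 1 + 'X *+ 2 + 'X^2 :> {poly R} by ring.
  have -> : (1 + 'X) * (1 - 'X) = 1 - 'X^2 :> {poly R} by ring.
  have -> : (1 - 'X) ^+ 2 = 1 - 'X *+ 2 + 'X^2 :> {poly R} by ring.
  apply/polyP => i; rewrite !coefE.
  by case: i => [|[|[|i]]] //=; rewrite ?mulr2n; field.
have sq : size q = 3%N by exact: size_monic_quadratic.
have sgE : size g = (size h).+2.
  by rewrite gE size_mul // -?size_poly_eq0 sq // addn3.
have sh : (0 < size h)%N by rewrite size_poly_gt0.
case: m => [|[|m]] in IHm sg *; [by rewrite sgE in sg| |].
  by rewrite sgE !ltnS leqn0 gtn_eqF in sg.
have := IHm m (leqW (ltnSn m)) h _ hh; rewrite -ltnS -ltnS -sgE => /(_ sg) Lh.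
have rA : r2 = a ^+ 2 + b ^+ 2 by [].
by case: Lh => Lh; [left; rewrite gE|right; rewrite gE -mulNr];
  rewrite mulrC -qE; apply: lorentz_nonneg_mul_quadratic => //; nra.
Qed.

(** * Values, derivatives and integrals of Bernstein polynomials *)

Lemma horner_bernstein m k (x : R) : (bernstein m k).[x] =
  2^-1 ^+ m * 'C(m, k)%:R * ((1 + x) ^+ k * (1 - x) ^+ (m - k)).
Proof. by rewrite /bernstein !hornerE. Qed.

Lemma bernstein_ge0 m k (x : R) : -1 <= x <= 1 -> 0 <= (bernstein m k).[x].
Proof.
move=> /andP[x1 x2]; rewrite horner_bernstein !mulr_ge0 ?exprn_ge0 ?invr_ge0 //.
  by rewrite -lerBlDl sub0r.
by rewrite subr_ge0.
Qed.

Lemma sum_bernstein m (x : R) : \sum_(k < m.+1) (bernstein m k).[x] = 1.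
Proof.
have <- : (2^-1 * ((1 - x) + (1 + x))) ^+ m = 1.
  by rewrite -[RHS](expr1n _ m); congr (_ ^+ m); field.
rewrite exprMn exprDn mulr_sumr; apply: eq_bigr => k _.
by rewrite horner_bernstein -mulrA mulr_natl (mulrC (_ ^+ k)).
Qed.

Lemma bernstein_max_ge m (x : R) : 0 <= x -> 2^-1 ^+ m <= (bernstein m m).[x].
Proof.
move=> x0; rewrite horner_bernstein binn subnn expr0 !mulr1 ler_peMr //.
  by rewrite exprn_ge0 ?invr_ge0.
by rewrite exprn_ege1 // lerDl.
Qed.

Lemma bernstein_min_ge m (x : R) : x <= 0 -> 2^-1 ^+ m <= (bernstein m 0).[x].
Proof.
move=> x0; rewrite horner_bernstein bin0 subn0 expr0 mul1r mulr1 ler_peMr //.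
  by rewrite exprn_ge0 ?invr_ge0.
by rewrite exprn_ege1 // lerDl oppr_ge0.
Qed.

(** The product rule, with the exponents absorbed into the binomials. The case [k = m] fits because
    [bernstein m m.+1] is 0. *)
Lemma deriv_bernstein m k : (k <= m)%N ->
  (bernstein m.+1 k.+1)^`() =
  (m.+1%:R / 2) *: (bernstein m k - bernstein m k.+1).
Proof.
move=> km; rewrite /bernstein derivZ derivM !deriv_exp !derivE add0r sub0r.
rewrite -pred_Sn subSS -subnS mul1r mulN1r mulNrn mulrN.
rewrite -[_ *+ k.+1]scaler_nat -[_ *+ (m - k)]scaler_nat -scalerAl -scalerAr.
rewrite !scalerBr !scalerA.
have e1 : (k.+1)%:R * ('C(m.+1, k.+1))%:R = m.+1%:R * 'C(m, k)%:R :> R.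
  by rewrite -!natrM -mul_bin_diag.
have e2 : (m - k)%:R * ('C(m.+1, k.+1))%:R = m.+1%:R * 'C(m, k.+1)%:R :> R.
  by rewrite -!natrM (mul_bin_down m.+1) subSS.
congr (_ *: _ - _ *: _); rewrite -mulrA [in LHS](mulrC (_%:R : R)).
  by rewrite e1 exprS; field.
by rewrite e2 exprS; field.
Qed.

(* The increment is [2 / m.+1] for every [k]: consecutive [bernstein m k]
   differ by the derivative of a polynomial vanishing at both endpoints. *)
Lemma bernstein_antiderivative m k : (k <= m)%N ->
  exists2 F : {poly R}, F^`() = bernstein m k & F.[1] - F.[-1] = 2 / m.+1%:R.
Proof.
have m0 : m.+1%:R != 0 :> R by rewrite pnatr_eq0.
pose step j := (2 / m.+1%:R) *: bernstein m.+1 j.+1.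
have dstep j : (j <= m)%N -> (step j)^`() = bernstein m j - bernstein m j.+1.
  move=> jm; rewrite derivZ deriv_bernstein // scalerA mulrA mulfVK //.
  by rewrite divff ?scale1r ?pnatr_eq0.
have stepN1 j : (step j).[-1] = 0.
  by rewrite hornerZ horner_bernstein subrr expr0n /= mul0r !mulr0.
have step1 j : (j < m)%N -> (step j).[1] = 0.
  move=> jm; rewrite hornerZ horner_bernstein subrr subSS.
  by rewrite expr0n subn_eq0 leqNgt jm !mulr0.
(* Downward induction on [k] from [m]: the telescoping starts at [step m], whose derivative is
   [bernstein m m] alone. *)
move=> /subnK; move: (m - k)%N => i; elim: i k => [|i IHi] k kE.
  rewrite add0n in kE; subst k; exists (step m).
    rewrite dstep // [X in _ - X](_ : _ = 0) ?subr0 //.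
    by rewrite /bernstein bin_small // mulr0 scale0r.
  rewrite stepN1 subr0 hornerZ horner_bernstein subnn expr0 binn !mulr1.
  by rewrite -exprMn mulVf ?expr1n ?mulr1 ?pnatr_eq0.
have km : (k < m)%N by rewrite -kE addSn ltnS leq_addl.
have [|F dF eF] := IHi k.+1; first by rewrite addnS -addSn.
exists (step k + F).
  by rewrite derivD dF dstep 1?ltnW // subrK.
by rewrite !hornerD stepN1 step1 // !add0r.
Qed.

Lemma eq_deriv_add_const f g :
  f^`() = g^`() -> exists c : R, f = g + c%:P.
Proof.
move=> dfg; have : size (f - g)^`() = 0%N by rewrite derivB dfg subrr size_poly0.
rewrite size_deriv => s0; have /size1_polyC fgE : (size (f - g)%R <= 1)%N.
  by case: size s0 => [|[]].
by exists ((f - g)`_0); rewrite -fgE addrC subrK.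
Qed.

(** Integration over [-1,1] term by term, done with explicit antiderivatives; the constant of
    integration cancels in the increment. *)
Lemma deriv_bernstein_increment m f (d : nat -> R) :
  f^`() = \sum_(k < m.+1) d k *: bernstein m k ->
  \sum_(k < m.+1) d k = m.+1%:R / 2 * (f.[1] - f.[-1]).
Proof.
move=> df; have m0 : m.+1%:R != 0 :> R by rewrite pnatr_eq0.
have [F dF eF] : exists2 F : {poly R}, F^`() = f^`() &
    F.[1] - F.[-1] = \sum_(k < m.+1) d k * (2 / m.+1%:R).
  rewrite {}df; elim/big_ind2: _ => [|_ s1 _ s2 [F <- <-] [G <- <-]|k _].
  - by exists 0; rewrite ?deriv0 // !horner0 subr0.
  - by exists (F + G); rewrite ?derivD // !hornerD opprD addrACA.
  - have [|F dF eF] := @bernstein_antiderivative m k; first by rewrite -ltnS.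
    by exists (d k *: F); rewrite ?derivZ ?dF // !hornerZ -mulrBr eF.
have [c ->] := eq_deriv_add_const (esym dF).
rewrite !hornerD !hornerC opprD addrACA subrr addr0 eF -mulr_suml.
rewrite -[m.+1%:R / 2]invf_div mulrCA mulVf ?mulr1 //.
by rewrite mulf_neq0 ?invr_eq0 // pnatr_eq0.
Qed.

(** * Supremum norm estimates *)

(** Each weight other than [w i] is at most their sum [1 - w i], hence at most [1 - e]. The
    subtracted term measures the loss caused by mass of [d] away from [i]. *)
Lemma convex_sum_le m (d w : nat -> R) (e : R) (i : 'I_m) :
  (forall k, 0 <= d k) -> (forall k, 0 <= w k) ->
  \sum_(k < m) w k = 1 -> e <= w i ->
  \sum_(k < m) d k * w k
    <= \sum_(k < m) d k - e * (\sum_(k < m) d k - d i).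
Proof.
move=> d0 w0.
have D (F : nat -> R) : \sum_(k < m) F k = F i + \sum_(k < m | k != i) F k.
  by rewrite (bigD1 i).
rewrite (D w) (D d) (D (fun k => d k * w k)).
rewrite [d i + _ - d i]addrAC subrr add0r => w1 ewi.
have wi1 : w i <= 1 by rewrite -w1 lerDl sumr_ge0.
have : \sum_(k < m | k != i) d k * w k
    <= (1 - e) * \sum_(k < m | k != i) d k.
  rewrite mulr_sumr; apply: ler_sum => k ki; rewrite mulrC ler_wpM2r //.
  have : w k <= \sum_(j < m | j != i) w j.
    by rewrite (bigD1 k) //= lerDl sumr_ge0.
  by lra.
have : d i * w i <= d i by rewrite ler_piMr.
by lra.
Qed.

Lemma horner_le_supnorm f (x : R) : -1 <= x <= 1 -> `|f.[x]| <= supnorm f.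
Proof.
move=> xI; apply: ub_le_sup; last by exists x => //=; rewrite in_itv.
have [M fM] := poly_itv_bound f (-1) 1; exists M => _ [y /= + <-].
by rewrite in_itv /= => /fM.
Qed.

Lemma supnorm_le f (M : R) :
  (forall x, -1 <= x <= 1 -> `|f.[x]| <= M) -> supnorm f <= M.
Proof.
move=> fM; apply: ge_sup.
  by exists `|f.[0]|, 0 => //=; rewrite in_itv /= lerN10 ler01.
by move=> _ [x /= + <-]; rewrite in_itv /= => /fM.
Qed.

Lemma supnormN f : supnorm (- f) = supnorm f.
Proof.
rewrite /supnorm; congr sup; apply: eq_imagel => x _.
by rewrite hornerN normrN.
Qed.

(** The weight bounded below by [2^-1 ^+ m] has index [m] for [x >= 0] and index 0 for [x < 0].
    Keeping the loss, rather than bounding by [S], is what settles the equality case. *)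
Lemma supnorm_deriv_bernstein m f (d : nat -> R) (S : R) :
  S = \sum_(k < m.+1) d k -> (forall k, 0 <= d k) ->
  f^`() = \sum_(k < m.+1) d k *: bernstein m k ->
  supnorm f^`() <=
    Num.max (S - 2^-1 ^+ m * (S - d m)) (S - 2^-1 ^+ m * (S - d 0%N)).
Proof.
move=> -> d0 df; apply: supnorm_le => x xI.
have w0 k : 0 <= (bernstein m k).[x] by exact: bernstein_ge0.
have dfx : f^`().[x] = \sum_(k < m.+1) d k * (bernstein m k).[x].
  by rewrite df horner_sum; apply: eq_bigr => k _; rewrite hornerZ.
rewrite ger0_norm dfx; last by apply: sumr_ge0 => k _; exact: mulr_ge0.
rewrite le_max; have [x0|x0] := leP 0 x; apply/orP; [left|right].
  apply: (convex_sum_le (w := fun k => (bernstein m k).[x]) (i := ord_max)) => //.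
    exact: sum_bernstein.
  exact: bernstein_max_ge.
apply: (convex_sum_le (w := fun k => (bernstein m k).[x]) (i := ord0)) => //.
  exact: sum_bernstein.
exact/bernstein_min_ge/ltW.
Qed.

(** * The inequality and its equality case *)

Lemma sum_eq_single m (d : nat -> R) (F : nat -> {poly R}) (i : 'I_m) :
  (forall k, 0 <= d k) -> \sum_(k < m) d k = d i ->
  \sum_(k < m) d k *: F k = d i *: F i.
Proof.
move=> d0; rewrite (bigD1 i) //= => /(canRL (addKr _)).
rewrite addNr => /psumr_eq0P s0.
rewrite (bigD1 i) //= big1 ?addr0 // => k ki.
by rewrite s0 ?scale0r // => j _.
Qed.

Lemma eq_of_deriv_endpoints f g : f^`() = g^`() ->
  f.[1] + f.[-1] = 0 -> g.[1] + g.[-1] = 0 -> f = g.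
Proof.
move=> /eq_deriv_add_const[c ->]; rewrite !hornerD !hornerC => h1 h2.
by rewrite (_ : c = 0) ?addr0 //; lra.
Qed.

(** The cone contains 0, so [c] may vanish here; the theorem excludes this afterwards. *)
Lemma markov_bernstein_nonneg m f : bernstein_nonneg m f^`() ->
  supnorm f^`() <= m.+1%:R * supnorm f /\
  (supnorm f^`() = m.+1%:R * supnorm f ->
   exists c : R,
     f = c *: ((1 + 'X) ^+ m.+1 - (2 ^+ m)%:P) \/
     f = c *: ((1 - 'X) ^+ m.+1 - (2 ^+ m)%:P)).
Proof.
move=> [d d0 df]; pose S := \sum_(k < m.+1) d k.
have := supnorm_deriv_bernstein (erefl S) d0 df; set e := 2^-1 ^+ m => supS.
have e0 : 0 < e by rewrite exprn_gt0 // invr_gt0.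
have dS (i : 'I_m.+1) : 0 <= S - d i.
  by rewrite /S (bigD1 i) //= addrAC subrr add0r sumr_ge0.
have dSm := dS ord_max; have dS0 := dS ord0; rewrite /= in dSm dS0.
have supS' : supnorm f^`() <= S.
  apply: le_trans supS _; rewrite ge_max !gerBl.
  by rewrite !mulr_ge0 // ltW.
have SE := deriv_bernstein_increment df; rewrite -/S in SE.
have m0 : 0 < m.+1%:R :> R by rewrite ltr0n.
have /ler_normlP[_ f1] : `|f.[1]| <= supnorm f.
  by apply: horner_le_supnorm; apply/andP; split; lra.
have /ler_normlP[fN1 _] : `|f.[-1]| <= supnorm f.
  by apply: horner_le_supnorm; apply/andP; split; lra.
have Sf : S <= m.+1%:R * supnorm f.
  by rewrite SE -mulrA ler_pM2l //; lra.
split=> [|eqf]; first exact: le_trans supS' Sf.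
have SE' : S = m.+1%:R * supnorm f by apply/le_anti; rewrite Sf -eqf supS'.
(* Equality forces [f.[1]] and [- f.[-1]], both at most [supnorm f], to have mean [supnorm f]; so
   both equal it. *)
have f11 : f.[1] + f.[-1] = 0.
  have : (f.[1] - f.[-1]) / 2 = supnorm f.
    by apply: (mulfI (lt0r_neq0 m0)); rewrite -SE' SE; field.
  by lra.
move: supS; rewrite eqf -SE' le_max => /orP[] h.
- have Sd : S = d m.
    have : e * (S - d m) <= 0 by lra.
    by rewrite pmulr_rle0 //; lra.
  (* The constant matches the derivatives, both [d m * e] times [(1 + 'X) ^+ m]. Subtracting
     [2 ^+ m] makes the values at 1 and -1 opposite, which fixes the constant of integration. *)
  exists (d m * e / m.+1%:R); left; apply: eq_of_deriv_endpoints => //.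
    rewrite df (@sum_eq_single _ d (bernstein m) ord_max) // /bernstein /=.
    rewrite binn subnn expr0 !mulr1 scalerA derivZ derivB derivC subr0.
    rewrite deriv_exp derivD derivX derivC add0r mul1r -scaler_nat scalerA.
    by rewrite divfK ?lt0r_neq0.
  by rewrite !hornerE subrr expr0n /= exprS; ring.
- have Sd : S = d 0%N.
    have : e * (S - d 0%N) <= 0 by lra.
    by rewrite pmulr_rle0 //; lra.
  (* The sign compensates the inner derivative of [1 - 'X]. *)
  exists (- (d 0%N * e / m.+1%:R)); right; apply: eq_of_deriv_endpoints => //.
    rewrite df (@sum_eq_single _ d (bernstein m) ord0) // /bernstein /=.
    rewrite bin0 subn0 expr0 mul1r !mulr1 scalerA derivZ derivB derivC subr0.
    rewrite deriv_exp derivB derivX derivC sub0r mulN1r mulNrn scaleNr scalerN.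
    by rewrite opprK -scaler_nat scalerA divfK ?lt0r_neq0.
  by rewrite !hornerE subrr expr0n /= exprS opprK; ring.
Qed.

End BernsteinForm.

Theorem theorem2p4 (R : realType) (n : nat) (hn : (0 < n)%N) (f : {poly R})
    (hdeg : (size f <= n.+1)%N) (hf : zeros_outside_open_disk f^`()) :
  supnorm f^`() <= n%:R * supnorm f /\
  (supnorm f^`() = n%:R * supnorm f ->
   exists2 c : R, c != 0 &
     f = c *: ((1 + 'X) ^+ n - (2 ^+ n.-1)%:P) \/
     f = c *: ((1 - 'X) ^+ n - (2 ^+ n.-1)%:P)).
Proof.
case: n hn hdeg => // m _ hdeg.
have sdf : (size f^`() <= m.+1)%N by rewrite size_deriv; case: (size f) hdeg.
have neq0 (c : R) p : f = c *: p -> c != 0.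
  move=> fE; apply: contra_neq (zeros_outside_open_disk_neq0 hf) => c0.
  by rewrite fE c0 scale0r deriv0.
have [/lorentz_nonneg_bernstein|/lorentz_nonneg_bernstein] :=
  zeros_outside_lorentz sdf hf.
  move=> /markov_bernstein_nonneg[le_f eq_f]; split=> // /eq_f[c fE].
  by exists c => //; case: fE => /neq0.
rewrite -derivN => /markov_bernstein_nonneg; rewrite derivN !supnormN.
move=> [le_f eq_f]; split=> // /eq_f[c fE].
have {}fE : f = - c *: ((1 + 'X) ^+ m.+1 - (2 ^+ m)%:P) \/
            f = - c *: ((1 - 'X) ^+ m.+1 - (2 ^+ m)%:P).
  by rewrite !scaleNr; case: fE => <-; rewrite opprK; [left|right].
by exists (- c) => //; case: fE => /neq0.
Qed.
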